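(* Let $\mathbf{M}$ be the multiplication table and $\mathbf{G}$ the scalar product table of the non-degenerate real Clifford algebra $C\ell_{p,q}$, $n=p+q$. Define the map $g:\mathbf{A}\mapsto \mathbf{G}\mathbf{A}$ (left multiplication by $\mathbf{G}$). Then: (1) For every basis blade $e_s$, one has $\pi_s = C_s\circ g = g\circ C_s$ on $\mathbf{M}$, i.e. $C_s(\mathbf{G}\mathbf{M})=\mathbf{G}\,C_s(\mathbf{M})=\mathbf{G}\mathbf{A}_s=\mathbf{E}_s$. (2) The map $\pi$ is an isomorphism of $C\ell_{p,q}(\mathbb{R})$ onto its image in the algebra $\mathrm{Mat}_{\mathbb{R}}(2^n\times 2^n)$ of real $2^n\times 2^n$ matrices, and so gives a representation of the Clifford algebra in the real matrix algebra. (3) $\pi$ distributes over the Clifford product: $\pi_{st}=\pi_s\pi_t$, i.e. $\pi(e_se_t)=\pi(e_s)\pi(e_t)$ for all basis blades $e_s,e_t$.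
   Context: $C\ell_{p,q}$ is the $2^n$-dimensional unital associative real algebra ($n=p+q$) generated by $e_1,\dots,e_n$ with $e_i^2=1$ for $i\le p$, $e_i^2=-1$ for $p<i\le n$, and $e_ie_j=-e_je_i$ for $i\ne j$. For $S=\{s_1<\dots<s_k\}\subseteq\{1,\dots,n\}$ write $e_S=e_{s_1}\cdots e_{s_k}$, with $e_\emptyset=1$. The extended basis $\mathbf{B}=\{e_S\}$ is the set of these $2^n$ blades, totally ordered with $1$ first; rows and columns of $2^n\times 2^n$ matrices are indexed by $\mathbf{B}$ in this order. The blade $e_S$ is also denoted $e_s$ by its ordinal $s$ in $\mathbf{B}$. The multiplication table $\mathbf{M}$ is the matrix whose entry in row $e_K$, column $e_L$ is the simplified product $e_Ke_L=m_{KL}\,e_{K\triangle L}$, $m_{KL}\in\{-1,1\}$ ($\triangle$ = symmetric difference). The coefficient map $C_s$ ($=C_S$) is applied entrywise to a matrix with entries in $C\ell_{p,q}$ and replaces each entry by the real coefficient of $e_S$ in its expansion in $\mathbf{B}$; put $\mathbf{A}_s=C_s(\mathbf{M})$. The scalar product table $\mathbf{G}$ is the real matrix with entries $e_K\ast e_L=\langle e_Ke_L\rangle_0$, where $\langle\cdot\rangle_0$ is the scalar (grade $0$) part; it is diagonal with entries $e_K^2=\pm1$. The canonical matrix map $\pi$ is defined by $\pi(e_s)=\mathbf{E}_s=\mathbf{G}\mathbf{A}_s$ on basis blades and extended linearly; $\pi_s$ denotes $\pi(e_s)$, and $\pi_{st}$ denotes $\pi(e_se_t)$. *)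

(* Defs.v *)
From mathcomp Require Import all_boot all_order all_algebra all_field.
From mathcomp Require Import reals.

Set Implicit Arguments.
Unset Strict Implicit.
Unset Printing Implicit Defensive.

Import GRing.Theory.
Local Open Scope ring_scope.

(* [A], with generators [e], is the Clifford algebra Cl_{p,q}.  Indices start
   at 0, so the first p generators are those with i < p.  [agenv] generates a
   unital subalgebra: it contains U ^+ 0 = 1. *)
Record is_clifford (R : realType) (p q : nat) (A : falgType R)
    (e : 'I_(p + q) -> A) : Prop := IsClifford {
  clifford_sqr : forall i, e i ^+ 2 = if (i < p)%N then 1 else -1;
  clifford_anti : forall i j, i != j -> e i * e j = - (e j * e i);
  clifford_gen : agenv <<codom e>> = fullv;
  clifford_dim : \dim {:A} = (2 ^ (p + q))%N
}.

(* The product runs over the elements of S in increasing order, since the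
   canonical enumeration of 'I_n is increasing. *)
Definition blade (R : realType) (A : falgType R) (n : nat) (e : 'I_n -> A)
    (S : {set 'I_n}) : A :=
  \prod_(i in S) e i.

Definition first_index (n : nat) : 'I_(2 ^ n) :=
  Ordinal (etrans (expn_gt0 2 n) isT : (0 < 2 ^ n)%N).

(* An ordering of the extended basis: [b s] is the set S such that the blade of
   ordinal s is e_S.  The order is arbitrary, except that e_set0 = 1 is first. *)
Definition basis_order (n : nat) (b : 'I_(2 ^ n) -> {set 'I_n}) : Prop :=
  bijective b /\ b (first_index n) = set0.

Section CanonicalMap.

Variables (R : realType) (A : falgType R) (n : nat).
Variables (e : 'I_n -> A) (b : 'I_(2 ^ n) -> {set 'I_n}).

Definition basis_blade (s : 'I_(2 ^ n)) : A := blade e (b s).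

Definition extended_basis : (2 ^ n).-tuple A :=
  [tuple basis_blade s | s < 2 ^ n].

Definition coef (s : 'I_(2 ^ n)) (x : A) : R := coord extended_basis s x.

Definition entrywise_coef (s : 'I_(2 ^ n)) (X : 'M[A]_(2 ^ n)) : 'M[R]_(2 ^ n) :=
  map_mx (coef s) X.

Definition scalar_part (x : A) : R := coef (first_index n) x.

Definition mult_table : 'M[A]_(2 ^ n) :=
  \matrix_(k, l) (basis_blade k * basis_blade l).

Definition scalar_table : 'M[R]_(2 ^ n) :=
  \matrix_(k, l) scalar_part (basis_blade k * basis_blade l).

(* Left multiplication by the scalar product table, on real matrices and on
   matrices over A; the latter reads real entries as scalars of A. *)
Definition g_real (X : 'M[R]_(2 ^ n)) : 'M[R]_(2 ^ n) := scalar_table *m X.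
Definition g_clifford (X : 'M[A]_(2 ^ n)) : 'M[A]_(2 ^ n) :=
  map_mx (in_alg A) scalar_table *m X.

Definition coef_table (s : 'I_(2 ^ n)) : 'M[R]_(2 ^ n) :=
  entrywise_coef s mult_table.

Definition canonical_matrix (s : 'I_(2 ^ n)) : 'M[R]_(2 ^ n) :=
  scalar_table *m coef_table s.

(* The linear extension of basis_blade s |-> canonical_matrix s. *)
Definition canonical_map (x : A) : 'M[R]_(2 ^ n) :=
  \sum_(s < 2 ^ n) coef s x *: canonical_matrix s.

End CanonicalMap.

(* Main.v *)
Require Import Defs.
From mathcomp Require Import all_boot all_order all_algebra all_field.
From mathcomp Require Import reals.
Import GRing.Theory.
Local Open Scope ring_scope.

(** Up to sign, blades multiply to blades and square to 1.  Hence if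
    [e_K e_L = m e_S] then [e_K e_S = e_K^2 m e_L], so that the entry (K, L) of
    [G A_S] is the coordinate of [e_K e_S] on [e_L].  In other words [pi x] is
    the matrix, acting on row vectors, of right multiplication by [x]: [pi] is
    the right regular representation, multiplicative by associativity and
    injective because its row of index [1] lists the coordinates of [x]. *)

(** * Equality up to sign as a congruence for the product *)

Section UpToSign.
Context {R : pzRingType} {A : algType R}.

(** With the sign as a boolean exponent, signs compose by [(+)] and each is its own inverse. *)
Definition eq_sign (x y : A) : Prop := exists c : bool, x = (-1) ^+ c *: y.

Lemma eq_sign_refl x : eq_sign x x.
Proof. by exists false; rewrite scale1r. Qed.

Lemma eq_sign_opp x : eq_sign (- x) x.
Proof. by exists true; rewrite scaleN1r. Qed.

Lemma eq_sign_sym {x y} : eq_sign x y -> eq_sign y x.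
Proof. by case=> c ->; exists c; rewrite scalerA -signr_addb addbb scale1r. Qed.

Lemma eq_sign_trans {x y z} : eq_sign x y -> eq_sign y z -> eq_sign x z.
Proof.
by case=> c -> [d ->]; exists (c (+) d); rewrite scalerA -signr_addb.
Qed.

Lemma eq_signM {x x' y y'} :
  eq_sign x x' -> eq_sign y y' -> eq_sign (x * y) (x' * y').
Proof.
case=> c -> [d ->]; exists (c (+) d).
by rewrite -scalerAl -scalerAr scalerA -signr_addb.
Qed.

Lemma eq_signMl z {x y} : eq_sign x y -> eq_sign (z * x) (z * y).
Proof. exact: eq_signM (eq_sign_refl z). Qed.

Lemma eq_signMr z {x y} : eq_sign x y -> eq_sign (x * z) (y * z).
Proof. by move=> xy; apply: eq_signM xy (eq_sign_refl z). Qed.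

End UpToSign.

(** * Products, squares and span of the blades *)

Section BladeProducts.
Context {R : realType} {A : falgType R} {n : nat} {e : 'I_n -> A}.
Hypothesis sqr_e : forall i, eq_sign (e i * e i) 1.
Hypothesis anti_e : forall i j, i != j -> e i * e j = - (e j * e i).

Lemma eq_sign_comm_e i j : eq_sign (e i * e j) (e j * e i).
Proof.
case: (eqVneq i j) => [->|/anti_e ->]; first exact: eq_sign_refl.
exact: eq_sign_opp.
Qed.

Lemma blade0 : blade e set0 = 1.
Proof. by rewrite /blade big_set0. Qed.

(** Moving [e i] to the front past each earlier factor costs only a sign. The filtered list makes
    induction on [r] possible. *)
Lemma prod_factor_out {i} {r : seq 'I_n} {P : pred 'I_n} :
    uniq r -> i \in r -> P i ->
  eq_sign (\prod_(j <- r | P j) e j)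
          (e i * \prod_(j <- r | P j && (j != i)) e j).
Proof.
elim: r => // k r IHr /= /andP[rk uniq_r]; rewrite inE !big_cons.
case: (eqVneq i k) => [->|ki] /= ir Pi.
  rewrite Pi andbF /=.
  (* As [r] has no duplicates, [k] does not recur in the tail and the extra filter is vacuous
     there. *)
  suff -> : \prod_(j <- r | P j && (j != k)) e j = \prod_(j <- r | P j) e j.
    exact: eq_sign_refl.
  rewrite big_seq_cond [RHS]big_seq_cond; apply: eq_bigl => j.
  by case: (eqVneq j k) => [->|_]; rewrite ?(negPf rk) ?andbT.
rewrite andbT; case: ifP => _; last exact: IHr.
apply: eq_sign_trans (eq_signMl _ (IHr uniq_r ir Pi)) _.
by rewrite !mulrA; apply/eq_signMr/eq_sign_comm_e.
Qed.

Lemma blade_factor_out {i} {S : {set 'I_n}} :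
  i \in S -> eq_sign (blade e S) (e i * blade e (S :\ i)).
Proof.
move=> iS; rewrite /blade.
under [X in e i * X]eq_bigl => j do rewrite !inE andbC.
by apply: prod_factor_out; rewrite ?index_enum_uniq ?mem_index_enum.
Qed.

(** [T] is [S] with [i] toggled: a second copy of [e i] squares away, a first one is inserted. *)
Lemma mul_e_blade i S : exists T, eq_sign (e i * blade e S) (blade e T).
Proof.
case: (boolP (i \in S)) => iS.
  exists (S :\ i); apply: eq_sign_trans (eq_signMl _ (blade_factor_out iS)) _.
  by rewrite mulrA -[X in eq_sign _ X]mul1r; apply/eq_signMr/sqr_e.
exists (i |: S); apply: eq_sign_sym.
by have := blade_factor_out (setU11 i S); rewrite setU1K.
Qed.

Lemma mul_blade K L : exists T, eq_sign (blade e K * blade e L) (blade e T).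
Proof.
(* Elements that carry blades to blades by left multiplication are closed under products and include
   the generators. *)
pose P x := forall S, exists T, eq_sign (x * blade e S) (blade e T).
suff: P (blade e K) by apply.
rewrite /blade; apply: big_ind => [S|x y Px Py S|i _]; last exact: mul_e_blade.
  by exists S; rewrite mul1r; apply: eq_sign_refl.
have [T yS] := Py S; have [U xT] := Px T; exists U.
by rewrite -mulrA; apply: eq_sign_trans xT; apply: eq_signMl.
Qed.

Lemma sqr_blade K : eq_sign (blade e K * blade e K) 1.
Proof.
(* The induction also carries commutation with generators up to sign, which reorders
   [e i * x * (e i * x)] into [e i * e i * (x * x)]. *)
pose P x := eq_sign (x * x) 1 /\ forall i, eq_sign (x * e i) (e i * x).
suff: P (blade e K) by case.
rewrite /blade; apply: big_rec => [|i x _ [xx xe]].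
  by split=> [|i]; rewrite mulr1 ?mul1r; apply: eq_sign_refl.
split=> [|j].
  have {xx} := eq_signM (sqr_e i) xx; rewrite mulr1; apply: eq_sign_trans.
  by rewrite -!mulrA; apply: eq_signMl; rewrite !mulrA; apply: eq_signMr.
rewrite -mulrA; apply: eq_sign_trans (eq_signMl _ (xe j)) _.
by rewrite !mulrA; apply/eq_signMr/eq_sign_comm_e.
Qed.

Lemma agenv_sub_span_blades : (agenv <<codom e>> <= <<codom (blade e)>>)%VS.
Proof.
have blade_span S : blade e S \in <<codom (blade e)>>%VS.
  by apply: memv_span; apply: codom_f.
(* It suffices that the span of the blades contains 1 and is stable under left multiplication by
   generators. *)
apply: agenv_sub_modl; first by have := blade_span set0; rewrite blade0 -memvE.
apply/prodvP=> u v /(coord_span (X := in_tuple _)) ->.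
move=> /(coord_span (X := in_tuple _)) ->.
rewrite mulr_suml memv_suml // => i _; rewrite mulr_sumr memv_suml // => j _.
rewrite -scalerAl -scalerAr !memvZ //=.
have /codomP[k ->] : (codom e)`_i \in codom e by rewrite mem_nth.
have /codomP[S ->] : (codom (blade e))`_j \in codom (blade e).
  by rewrite mem_nth.
by have [T [d ->]] := mul_e_blade k S; rewrite memvZ.
Qed.

End BladeProducts.

(** * The canonical map as the right regular representation *)

Section CanonicalMapTheory.
Context {R : realType} {A : falgType R} {n : nat}.
Context {e : 'I_n -> A} {b : 'I_(2 ^ n) -> {set 'I_n}}.
Hypothesis sqr_e : forall i, eq_sign (e i * e i) 1.
Hypothesis anti_e : forall i j, i != j -> e i * e j = - (e j * e i).
Hypothesis basis_e : basis_of fullv (extended_basis e b).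
Hypothesis order_b : basis_order b.

Local Notation B := (basis_blade e b).
Local Notation c := (coef e b).
Local Notation i0 := (first_index n).

Lemma extended_basis_nth (s : 'I_(2 ^ n)) : (extended_basis e b)`_s = B s.
Proof. by rewrite -tnth_nth tnth_mktuple. Qed.

Lemma coefD s x y : c s (x + y) = c s x + c s y.
Proof. by rewrite /coef linearD. Qed.

Lemma coefZ s a x : c s (a *: x) = a * c s x.
Proof. by rewrite /coef linearZ. Qed.

Lemma coef_sum s (I : finType) (F : I -> A) :
  c s (\sum_i F i) = \sum_i c s (F i).
Proof. by rewrite /coef linear_sum. Qed.

Lemma coef_basis_blade s t : c s (B t) = (t == s)%:R.
Proof.
by rewrite -extended_basis_nth /coef coord_free // (basis_free basis_e).
Qed.

Lemma coef_expand x : x = \sum_s c s x *: B s.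
Proof.
rewrite {1}(coord_basis basis_e (memvf x)).
by apply: eq_bigr => s _; rewrite extended_basis_nth.
Qed.

Lemma basis_blade_first : B i0 = 1.
Proof. by rewrite /basis_blade order_b.2 blade0. Qed.

Lemma basis_blade_inj s t : eq_sign (B s) (B t) -> s = t.
Proof.
case=> d /(congr1 (c s)) /eqP; rewrite coefZ !coef_basis_blade eqxx.
by case: (eqVneq t s) => // _; rewrite mulr0 oner_eq0.
Qed.

Lemma mul_basis_blade k l : exists s, eq_sign (B k * B l) (B s).
Proof.
have [T eT] := mul_blade sqr_e anti_e (b k) (b l).
by have [f _ bK] := order_b.1; exists (f T); rewrite /basis_blade bK.
Qed.

(** Since [B k] squares to 1 up to sign, left multiplication by it is an involution up to sign. *)
Lemma mul_basis_blade_swap {k x y} :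
  eq_sign (B k * x) y -> eq_sign (B k * y) x.
Proof.
move=> /(eq_signMl (B k)) /eq_sign_sym; rewrite mulrA => /eq_sign_trans; apply.
by rewrite -[X in eq_sign _ X]mul1r; apply/eq_signMr/sqr_blade.
Qed.

Lemma scalar_table_diag k l : k != l -> scalar_table e b k l = 0.
Proof.
move=> kl; rewrite mxE; have [t klt] := mul_basis_blade k l.
(* If the product were 1 up to sign, swapping would give [B k] equal to [B l] up to sign. *)
have ti0 : t != i0.
  apply: contraNneq kl => ti0; apply/eqP/basis_blade_inj.
  have := mul_basis_blade_swap klt.
  by rewrite ti0 basis_blade_first mulr1.
case: klt => d ->.
by rewrite /scalar_part coefZ coef_basis_blade (negPf ti0) mulr0n mulr0.
Qed.

Lemma scalar_tableE k : B k * B k = scalar_table e b k k *: 1.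
Proof.
have [d kk] : eq_sign (B k * B k) 1 by apply: sqr_blade.
rewrite mxE /scalar_part kk coefZ.
by rewrite -{2}basis_blade_first coef_basis_blade eqxx mulr1.
Qed.

Lemma canonical_matrixE s k l :
  canonical_matrix e b s k l = c l (B k * B s).
Proof.
rewrite mxE (bigD1 k) //= big1 ?addr0 => [|j jk]; last first.
  by rewrite scalar_table_diag ?mul0r // eq_sym.
rewrite [coef_table _ _ _ _ _]mxE [mult_table _ _ _ _]mxE.
(* Only the diagonal entry of [G] is left. If [t = s], both sides are the square of [B k] times the
   sign of [B k * B l]; otherwise both vanish. *)
have [t klt] := mul_basis_blade k l; case: (eqVneq t s) => [ts|ts].
  have [d kls] := klt; rewrite ts in kls.
  suff -> : B k * B s = (scalar_table e b k k * (-1) ^+ d) *: B l.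
    by rewrite kls !coefZ !coef_basis_blade !eqxx !mulr1.
  (* Left multiplication by [B k] brings out its square; the sign then changes sides, being its own
     inverse. *)
  have := congr1 ( *%R (B k)) kls.
  rewrite mulrA scalar_tableE -scalerAr -scalerAl mul1r => /esym.
  move/(congr1 ( *:%R ((-1) ^+ d))).
  by rewrite !scalerA -signr_addb addbb scale1r mulrC.
have [u ksu] := mul_basis_blade k s.
(* Were [u = l], swapping would make [B k * B l] a multiple of [B s], against [t != s]. *)
have ul : u != l.
  apply: contraNneq ts => ul; apply/eqP/basis_blade_inj.
  apply: eq_sign_trans (eq_sign_sym klt) _.
  by apply: mul_basis_blade_swap; rewrite -ul.
case: klt ksu => d -> [d' ->].
by rewrite !coefZ !coef_basis_blade (negPf ts) (negPf ul) !mulr0n !mulr0.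
Qed.

Lemma canonical_mapE x k l : canonical_map e b x k l = c l (B k * x).
Proof.
rewrite {2}(coef_expand x) mulr_sumr coef_sum /canonical_map summxE.
by apply: eq_bigr => s _; rewrite mxE canonical_matrixE -scalerAr coefZ.
Qed.

Lemma canonical_map_basis_blade s :
  canonical_map e b (B s) = canonical_matrix e b s.
Proof. by apply/matrixP=> k l; rewrite canonical_mapE canonical_matrixE. Qed.

Lemma canonical_map_linear : linear (canonical_map e b).
Proof.
move=> a x y; apply/matrixP=> k l; rewrite !mxE !canonical_mapE.
by rewrite mulrDr -scalerAr coefD coefZ.
Qed.

Lemma canonical_map1 : canonical_map e b 1 = 1%:M.
Proof.
by apply/matrixP=> k l; rewrite canonical_mapE mulr1 coef_basis_blade mxE.
Qed.

Lemma canonical_mapM x y :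
  canonical_map e b (x * y) = canonical_map e b x *m canonical_map e b y.
Proof.
apply/matrixP=> k l; rewrite canonical_mapE mulrA mxE.
(* Row [k] of the image of [x] lists the coordinates of [B k * x], so this expansion is the
   row-by-column sum. *)
rewrite {1}(coef_expand (B k * x)) mulr_suml coef_sum.
by apply: eq_bigr => j _; rewrite -scalerAl coefZ !canonical_mapE.
Qed.

Lemma canonical_map_inj : injective (canonical_map e b).
Proof.
move=> x y /matrixP eq_xy; rewrite (coef_expand x) (coef_expand y).
apply: eq_bigr => s _; have := eq_xy i0 s.
by rewrite !canonical_mapE basis_blade_first !mul1r => ->.
Qed.

(** The entries of [G] are real scalars, and taking a coordinate is linear over the reals. *)
Lemma entrywise_coef_g s (X : 'M[A]_(2 ^ n)) :
  entrywise_coef e b s (g_clifford e b X) = g_real e b (entrywise_coef e b s X).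
Proof.
apply/matrixP=> k l; rewrite !mxE coef_sum; apply: eq_bigr => j _.
by rewrite !mxE mulr_algl coefZ.
Qed.

End CanonicalMapTheory.

(** * The blades form a basis of the Clifford algebra *)

Section CliffordBasis.
Context {R : realType} {p q : nat} {A : falgType R} {e : 'I_(p + q) -> A}.
Hypothesis clifford_e : is_clifford e.

Lemma clifford_sqr_sign i : eq_sign (e i * e i) 1.
Proof.
rewrite -expr2 (clifford_sqr clifford_e); case: ifP => _.
  exact: eq_sign_refl.
exact: eq_sign_opp.
Qed.

Lemma clifford_basis {b : 'I_(2 ^ (p + q)) -> {set 'I_(p + q)}} :
  basis_order b -> basis_of fullv (extended_basis e b).
Proof.
(* A spanning family whose size is the dimension is a basis. *)
case=> [[f _ bK] _]; rewrite basisEdim size_tuple (clifford_dim clifford_e).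
rewrite leqnn andbT -(clifford_gen clifford_e).
apply: subv_trans (agenv_sub_span_blades clifford_sqr_sign _) _.
  exact: clifford_anti.
(* Surjectivity of [b] lists every blade in the extended basis. *)
apply: sub_span => _ /codomP[S ->]; apply/tnthP; exists (f S).
by rewrite tnth_mktuple /basis_blade bK.
Qed.

End CliffordBasis.

Theorem theorem7 (R : realType) (p q : nat) (A : falgType R)
    (e : 'I_(p + q) -> A) (b : 'I_(2 ^ (p + q)) -> {set 'I_(p + q)})
    (He : is_clifford e) (Hb : basis_order b) :
  [/\ (* (1) *)
      forall s : 'I_(2 ^ (p + q)),
        [/\ entrywise_coef e b s (g_clifford e b (mult_table e b))
              = g_real e b (entrywise_coef e b s (mult_table e b)),
            g_real e b (entrywise_coef e b s (mult_table e b))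
              = scalar_table e b *m coef_table e b s,
            scalar_table e b *m coef_table e b s = canonical_matrix e b s
          & canonical_map e b (basis_blade e b s) = canonical_matrix e b s],
      (* (2): an injective homomorphism of unital algebras *)
      [/\ linear (canonical_map e b),
          GRing.monoid_morphism (canonical_map e b)
        & injective (canonical_map e b)]
    & (* (3) *)
      forall s t : 'I_(2 ^ (p + q)),
        canonical_map e b (basis_blade e b s * basis_blade e b t)
        = canonical_map e b (basis_blade e b s)
            *m canonical_map e b (basis_blade e b t)].
Proof.
have sqr_e := clifford_sqr_sign He.
have anti_e := clifford_anti He.
have basis_e := clifford_basis He Hb.
split.
- move=> s; split=> //; first exact: entrywise_coef_g.
  exact: canonical_map_basis_blade.
- split; [exact: canonical_map_linear | split | exact: canonical_map_inj].
  + exact: canonical_map1.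
  + exact: canonical_mapM.
- by move=> s t; apply: canonical_mapM.
Qed.
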